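(* Let $(\Delta_K,\Delta_G,\Delta_H)$ be a Zappa–Szép Garside structure for the Zappa–Szép product $K=G\bowtie H$. Then the map $\psi:\overline{\mathcal L}_G\times\overline{\mathcal L}_H\to\overline{\mathcal L}_K$ given by \[\psi\big(g_1|g_2|\cdots|g_m\,,\,h_1|h_2|\cdots|h_n\big)=\mathrm{NF}\big((g_1g_2\cdots g_m)\vee(h_1h_2\cdots h_n)\big)\] is a bijection.
   Context: Zappa–Szép product: for a monoid $K$ with submonoids $G,H$, write $K=G\bowtie H$ if for every $k\in K$ there exist unique $g_1,g_2\in G$ and $h_1,h_2\in H$ such that $g_1h_1=k=h_2g_2$. Garside monoids: in a monoid $M$ with identity $\mathbf 1$, write $x\preccurlyeq y$ ($x$ is a prefix of $y$) if $y=xu$ for some $u\in M$, and $y\succcurlyeq x$ ($x$ is a suffix of $y$) if $y=ux$ for some $u\in M$. An atom is an element $a\neq\mathbf 1$ such that $a=uv$ implies $u=\mathbf 1$ or $v=\mathbf 1$. $M$ is atomic if it is generated by its atoms and for each $x\in M$ there is an upper bound on the lengths of decompositions of $x$ as a product of atoms. An element is balanced if its set of prefixes equals its set of suffixes; this common set is denoted $\mathrm{Div}(d)$. A Garside structure is a pair $(M,\Delta)$ where $M$ is a cancellative atomic monoid, the prefix and suffix relations are lattice orders, $\Delta\in M$ is balanced, $M$ is generated by $\mathrm{Div}(\Delta)$, and $\mathrm{Div}(\Delta)$ is finite. $M$ is a Garside monoid if such a $\Delta$ (a Garside element) exists. Zappa–Szép Garside structure: $(\Delta_K,\Delta_G,\Delta_H)$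 is one for $K=G\bowtie H$ if $K$ is a Garside monoid (it then follows that $G$ and $H$ are Garside monoids), $\Delta_K,\Delta_G,\Delta_H$ are Garside elements of $K,G,H$ respectively, and $\Delta_K=\Delta_G\Delta_H$. Normal forms: for $M\in\{K,G,H\}$ let $\mathcal D_M=\mathrm{Div}(\Delta_M)$ and, for $x\in\mathcal D_M$, let $\partial_Mx\in\mathcal D_M$ be the unique element with $x\,\partial_Mx=\Delta_M$. Let $\wedge$ and $\vee$ denote the meet and join for the prefix order ($\vee$ in the claim is taken in $K$). $\overline{\mathcal L}_M$ is the set of all words $x_1.x_2.\cdots.x_n$ ($n\ge 0$, including the empty word) over the alphabet $\mathcal D_M\setminus\{\mathbf 1\}$ such that $\partial_Mx_i\wedge x_{i+1}=\mathbf 1$ for $1\le i<n$ (words in left normal form); $x_1|\cdots|x_n$ denotes such a word. For $x\in M$, $\mathrm{NF}(x)$ is the unique word $x_1|\cdots|x_n\in\overline{\mathcal L}_M$ with $x=x_1\cdots x_n$; in the claim $\mathrm{NF}$ is taken in $K$ with respect to $\Delta_K$. *)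

(* Defs.v *)
From mathcomp Require Import all_boot.
From mathcomp Require Import boolp classical_sets functions cardinality.

Set Implicit Arguments.
Unset Strict Implicit.
Unset Printing Implicit Defensive.

Local Open Scope classical_set_scope.
Local Open Scope group_scope.

Section LatticeOrder.
Variables (T : Type) (R : T -> T -> Prop).

Definition is_meet (x y m : T) : Prop :=
  [/\ R m x, R m y & forall z, R z x -> R z y -> R z m].

Definition is_join (x y j : T) : Prop :=
  [/\ R x j, R y j & forall z, R x z -> R y z -> R j z].

Definition lattice_order : Prop :=
  [/\ forall x, R x x,
      forall x y, R x y -> R y x -> x = y,
      forall x y z, R x y -> R y z -> R x z,
      forall x y, exists m, is_meet x y m
    & forall x y, exists j, is_join x y j].

End LatticeOrder.

Section Garside.
Variable M : monoidType.
Implicit Types (x y a d : M) (w : seq M).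

Definition prefix_of x y : Prop := exists u, y = x * u.

(* suffix_of x y is the relation y ≽ x. *)
Definition suffix_of x y : Prop := exists u, y = u * x.

Definition atom a : Prop :=
  a <> 1 /\ forall u v, a = u * v -> u = 1 \/ v = 1.

Definition generated_by (S : set M) : Prop :=
  forall x, exists2 w, (forall y, y \in w -> S y) & x = \prod_(y <- w) y.

Definition atomic : Prop :=
  generated_by atom /\
  forall x, exists n : nat, forall w,
    (forall a, a \in w -> atom a) -> x = \prod_(a <- w) a -> (size w <= n)%N.

Definition cancellative : Prop :=
  right_injective (@mul M) /\ left_injective (@mul M).

Definition balanced d : Prop := forall x, prefix_of x d <-> suffix_of x d.

(* Only used for balanced d, where prefixes and suffixes coincide. *)
Definition Div d : set M := [set x | prefix_of x d].

Definition garside_element d : Prop :=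
  [/\ cancellative /\ atomic,
      lattice_order prefix_of /\ lattice_order suffix_of,
      balanced d,
      generated_by (Div d)
    & finite_set (Div d)].

Definition garside_monoid : Prop := exists d, garside_element d.

(* [xget x0 A] is an element of [A], or [x0] when [A] is empty; in a Garside
   monoid none of the sets below is empty, and each is a singleton (for
   [complement] when x is in Div d, as in [left_normal]). *)
Definition meet x y : M := xget 1 [set m | is_meet prefix_of x y m].

Definition join x y : M := xget 1 [set j | is_join prefix_of x y j].

(* The element written ∂x, for the Garside element d. *)
Definition complement d x : M := xget 1 [set y | Div d y /\ x * y = d].

Definition left_normal d : set (seq M) :=
  [set w | (forall x, x \in w -> Div d x /\ x <> 1) /\
           (forall i : nat, (i.+1 < size w)%N ->
              meet (complement d (nth 1 w i)) (nth 1 w i.+1) = 1)].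

Definition NF d x : seq M :=
  xget [::] [set w | left_normal d w /\ x = \prod_(y <- w) y].

End Garside.

Section ZappaSzep.
Variables (K : monoidType) (PG PH : pred K).
Variables (G : subMonoidType PG) (H : subMonoidType PH).

Definition zappa_szep : Prop :=
  forall k : K, exists! q : (G * G) * (H * H),
    let: ((g1, g2), (h1, h2)) := q in
    val g1 * val h1 = k /\ k = val h2 * val g2.

Definition zappa_szep_garside (dK : K) (dG : G) (dH : H) : Prop :=
  [/\ garside_monoid K,
      garside_element dK, garside_element dG, garside_element dH
    & dK = val dG * val dH].

Definition psi (dK : K) (w : seq G * seq H) : seq K :=
  NF dK (join (val (\prod_(g <- w.1) g)) (val (\prod_(h <- w.2) h))).

End ZappaSzep.

(* Main.v *)
(* In a Garside monoid the first letter of a left normal word is the meet of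
   the Garside element with the product of the word, so normal words correspond
   bijectively to elements, and it suffices that [(g, h) |-> g \/ h] is a
   bijection from [G * H] to [K]. If [k = g h' = h g'], then [k] is the join of
   [g] and [h], which gives surjectivity and, by uniqueness of the
   factorizations, reduces injectivity to the existence, for all [g] and [h], of
   [g'] and [h'] with [g h' = h g'].  For divisors of [dG] and [dH] this follows
   from [dK = dG dH = dH dG] by a finiteness argument, and in general by tiling
   a grid with such squares. *)
Require Import Defs.
From mathcomp Require Import all_boot.
From mathcomp Require Import boolp classical_sets functions cardinality.

Local Open Scope classical_set_scope.

(** Pigeonhole: the image of a duplicate-free enumeration of [A] is again duplicate-free, has the
    same length and lies inside it. *)
Lemma finite_set_inj_surj {T : choiceType} {A : set T} {f : T -> T} :
  finite_set A -> set_fun A A f -> set_inj A f -> set_surj A A f.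
Proof.
move=> /finite_seqP[s ->] fA finj y ys.
have us : uniq [seq f x | x <- undup s].
  rewrite map_inj_in_uniq ?undup_uniq // => x x'.
  by rewrite !mem_undup => xs x's; apply: finj; rewrite in_setE.
have sub : {subset [seq f x | x <- undup s] <= undup s}.
  by move=> z /mapP[x]; rewrite !mem_undup => xs ->; exact: fA.
have [|_ eqs] := uniq_min_size us sub; first by rewrite size_map.
have : y \in [seq f x | x <- undup s] by rewrite eqs mem_undup.
by move=> /mapP[x]; rewrite mem_undup => xs ->; exists x.
Qed.

(** * Left normal forms in a Garside monoid *)

Section GarsideMonoid.
Local Set Implicit Arguments.
Local Unset Strict Implicit.
Local Open Scope group_scope.
Variables (M : monoidType) (d : M).
Hypothesis gd : garside_element d.
Implicit Types (x y z : M) (w : seq M).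

Lemma mulMI {x y z} : x * y = x * z -> y = z.
Proof. by case: gd => -[[mI _] _] _ _ _ _; apply: mI. Qed.

Lemma prefix_anti {x y} : prefix_of x y -> prefix_of y x -> x = y.
Proof. by case: gd => _ [[_ anti _ _ _] _] _ _ _; apply: anti. Qed.

Lemma suffix_anti {x y} : suffix_of x y -> suffix_of y x -> x = y.
Proof. by case: gd => _ [_ [_ anti _ _ _]] _ _ _; apply: anti. Qed.

Lemma prefix_trans {x y z} : prefix_of x y -> prefix_of y z -> prefix_of x z.
Proof. by case: gd => _ [[_ _ trans _ _] _] _ _ _; apply: trans. Qed.

Lemma prefix_mul2l {x y z} : prefix_of (x * y) (x * z) -> prefix_of y z.
Proof. by case=> u; rewrite -mulgA => /mulMI ->; exists u. Qed.

Lemma mul_eq1 {x y} : x * y = 1 -> x = 1 /\ y = 1.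
Proof.
move=> xy1; have x1 : x = 1.
  by apply: prefix_anti; [exists y | exists x; rewrite mul1g].
by move: xy1; rewrite x1 mul1g.
Qed.

Lemma prefix1 {x} : prefix_of x 1 -> x = 1.
Proof. by case=> u /esym/mul_eq1[]. Qed.

Lemma DivP x : Div d x <-> suffix_of x d.
Proof. by case: gd => _ _ bal _ _; apply: bal. Qed.

Lemma Div_prefix {x y} : prefix_of x y -> Div d y -> Div d x.
Proof. exact: prefix_trans. Qed.

Lemma Div_suffix {x y} : suffix_of x y -> Div d y -> Div d x.
Proof.
by move=> [u ->] /DivP[v dE]; apply/DivP; exists (v * u); rewrite -mulgA.
Qed.

Lemma meet_eq x y z : is_meet (@prefix_of _) x y z -> meet x y = z.
Proof.
move=> [zx zy zmax]; apply: xget_unique => // z' [z'x z'y z'max].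
by apply: prefix_anti; [exact: zmax | exact: z'max].
Qed.

Lemma join_eq x y z : is_join (@prefix_of _) x y z -> join x y = z.
Proof.
move=> [zx zy zmin]; apply: xget_unique => // z' [z'x z'y z'min].
by apply: prefix_anti; [exact: z'min | exact: zmin].
Qed.

Lemma ex_meet x y : exists z, is_meet (@prefix_of _) x y z.
Proof. by case: gd => _ [[_ _ _ em _] _] _ _ _; apply: em. Qed.

Lemma ex_join x y : exists z, is_join (@prefix_of _) x y z.
Proof. by case: gd => _ [[_ _ _ _ ej] _] _ _ _; apply: ej. Qed.

Lemma meetP x y : is_meet (@prefix_of _) x y (meet x y).
Proof. by have [z zP] := ex_meet x y; rewrite (meet_eq zP). Qed.

Lemma complementP {x} : Div d x -> x * complement d x = d.
Proof.
move=> [y dE].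
have ex : exists y, [set y | Div d y /\ x * y = d] y.
  by exists y; split=> //; apply/DivP; exists x.
by have [_] := xgetPex 1 ex.
Qed.

(** Cancelling [x] in [x * complement d x = d] identifies the prefixes of the complement with the
    [z] such that [x * z] divides [d]. *)
Lemma meet_complement {x y} :
  Div d x -> meet (complement d x) y = 1 <->
  forall z, prefix_of (x * z) d -> prefix_of z y -> z = 1.
Proof.
move=> dx; split=> [m1 z|m1].
  rewrite -{1}(complementP dx) => /prefix_mul2l zc zy.
  by apply: prefix1; rewrite -m1; have [_ _] := meetP (complement d x) y; apply.
have [mc my _] := meetP (complement d x) y; apply: m1 => //.
by case: mc => u uE; exists u; rewrite -mulgA -uE complementP.
Qed.

Lemma left_normal_cons x w :
  left_normal d (x :: w) <->
  [/\ Div d x, x <> 1, left_normal d w & meet (complement d x) (head 1 w) = 1].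
Proof.
split=> [[wd wn]|[dx x1 [wd wn] mw]].
  have [dx x1] := wd x (mem_head _ _); split=> //.
    split=> [y yw|i iw]; first by apply: wd; rewrite inE yw orbT.
    exact: (wn i.+1).
  (* For empty [w] the default head [1] makes the meet trivial, so the condition on the head is no
     constraint. *)
  case: w wd wn => [_ _|y w _ wn] /=; last exact: (wn 0).
  apply: meet_eq; split=> [|//|z _ //].
    by exists (complement d x); rewrite mul1g.
  by exists 1; rewrite mulg1.
split=> [y|[|i] /= iw]; first by rewrite inE => /predU1P[->|/wd].
  by case: w iw mw {wd wn}.
exact: wn.
Qed.

(** If [z] is a common prefix, the join of [x] and [z] has the form [x * t] and still divides [d]
    and the product. Then [t] divides [d] and the product of the tail, hence by induction the second
    letter; normality forces [t = 1]. *)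
Lemma left_normal_head x w : left_normal d (x :: w) ->
  is_meet (@prefix_of _) d (\prod_(y <- x :: w) y) x.
Proof.
elim: w x => [|x' w IHw] x /left_normal_cons[dx _ nw mw]; rewrite big_cons.
  rewrite big_nil mulg1; split=> //; by exists 1; rewrite mulg1.
have [_ _ x'max] := IHw _ nw; split=> //.
  by exists (\prod_(y <- x' :: w) y).
move=> z zd zxw; have [j [[t jE] zj jmin]] := ex_join x z.
have jd : prefix_of j d by apply: jmin.
have jxw : prefix_of j (x * \prod_(y <- x' :: w) y).
  by apply: jmin => //; exists (\prod_(y <- x' :: w) y).
have td : prefix_of t d by apply: (@Div_suffix _ j) => //; exists x.
suff t1 : t = 1 by rewrite jE t1 mulg1 in zj.
apply: ((meet_complement dx).1 mw t); first by rewrite -jE.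
by apply: x'max => //; apply: (@prefix_mul2l x); rewrite -jE.
Qed.

Lemma left_normal_inj w w' : left_normal d w -> left_normal d w' ->
  \prod_(y <- w) y = \prod_(y <- w') y -> w = w'.
Proof.
elim: w w' => [|x w IHw] [|x' w'] // nw nw'.
- rewrite big_nil big_cons => /esym/mul_eq1[x'1 _].
  by case/left_normal_cons: nw'.
- rewrite big_nil big_cons => /mul_eq1[x1 _].
  by case/left_normal_cons: nw.
move=> eqw; have xx' : x = x'.
  rewrite -(meet_eq (left_normal_head nw)) eqw.
  exact: meet_eq (left_normal_head nw').
move: eqw; rewrite !big_cons xx' => /mulMI eqw; congr (_ :: _).
by apply: IHw => //; [case/left_normal_cons: nw | case/left_normal_cons: nw'].
Qed.

(** The first nontrivial letter of a factorization into divisors of [d] is a common prefix of [d]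
    and [x]. *)
Lemma meet_d_neq1 x : x <> 1 -> meet d x <> 1.
Proof.
case: gd => _ _ _ gen _; have [w wd ->] := gen x.
elim: w wd => [|y w IHw] wd; first by rewrite big_nil.
rewrite big_cons; have [->|/eqP y1 _ m1] := eqVneq y 1.
  by rewrite mul1g; apply: IHw => z zw; apply: wd; rewrite inE zw orbT.
apply/y1/prefix1; rewrite -m1.
have [_ _] := meetP d (y * \prod_(y <- w) y); apply.
  by apply: wd; rewrite mem_head.
by exists (\prod_(y <- w) y).
Qed.

(** Greedy algorithm: split off [meet d x] and recurse. The induction is on a bound for atomic
    lengths, which drops because the nontrivial meet contributes at least one atom. *)
Lemma left_normal_ex x : exists2 w, left_normal d w & x = \prod_(y <- w) y.
Proof.
case: gd => -[_ [gen bound]] _ _ _ _.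
have [n] := bound x; elim: n x => [|n IHn] x xn.
  have [w wa xE] := gen x; exists [::]; first by split.
  by have := xn w wa xE; rewrite leqn0 => /nilP w0; rewrite xE w0.
have [->|/eqP x1] := eqVneq x 1.
  by exists [::]; [split | rewrite big_nil].
have m1 := meet_d_neq1 x1; have [md mx mmax] := meetP d x.
set m := meet d x in m1 md mx mmax *; case: mx => x' xE.
have [|w nw x'E] := IHn x'.
  move=> w wa x'E; have [v va mE] := gen m.
  case: v va mE => [|a v] va mE; first by rewrite mE big_nil in m1.
  have := xn ((a :: v) ++ w); rewrite size_cat /= ltnS => le_n.
  apply: leq_trans (le_n _ _); first exact: leq_addl.
    by move=> b; rewrite -cat_cons mem_cat => /orP[/va|/wa].
  by rewrite -cat_cons big_cat /= -mE -x'E.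
exists (m :: w); last by rewrite big_cons -x'E.
apply/left_normal_cons; split=> //; apply/(meet_complement md) => z mzd zw.
(* [m * z] divides [d] and is a prefix of [x], so maximality of the meet [m] applies. *)
have : prefix_of (m * z) (m * 1).
  rewrite mulg1; apply: mmax => //; rewrite xE x'E.
  case: (w) zw => [/prefix1->|y v]; first by exists 1; rewrite big_nil !mulg1.
  by move=> [u /= ->]; exists (u * \prod_(y <- v) y); rewrite big_cons !mulgA.
by move=> /prefix_mul2l/prefix1.
Qed.

Lemma NFP x : left_normal d (NF d x) /\ x = \prod_(y <- NF d x) y.
Proof.
have [w nw xE] := left_normal_ex x; apply: (@xgetPex _ [::]
  [set w | left_normal d w /\ x = \prod_(y <- w) y]).
by exists w.
Qed.

Lemma NF_inj x y : NF d x = NF d y -> x = y.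
Proof.
by move=> eqxy; have [[_ ->] [_ ->]] := (NFP x, NFP y); rewrite eqxy.
Qed.

Lemma NF_prod w : left_normal d w -> NF d (\prod_(y <- w) y) = w.
Proof.
by move=> nw; have [nw' eqw] := NFP (\prod_(y <- w) y); exact: left_normal_inj.
Qed.

End GarsideMonoid.

(** * Divisibility in a Zappa-Szép product *)

Section ZappaSzepProduct.
Local Set Implicit Arguments.
Local Unset Strict Implicit.
Local Open Scope group_scope.
Variables (K : monoidType) (PG PH : pred K).
Variables (G : subMonoidType PG) (H : subMonoidType PH).
Hypothesis zs : zappa_szep G H.
Implicit Types (g : G) (h : H) (k : K).

(** This symmetry lets every later statement be used with the roles of [G] and [H] exchanged. *)
Lemma zs_sym : zappa_szep H G.
Proof.
move=> k; have [[[g1 g2] [h1 h2]] [[kE1 kE2] uniq]] := zs k.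
exists ((h2, h1), (g2, g1)); split=> // -[[h1' h2'] [g1' g2']] [kE3 kE4].
have := uniq ((g2', g1'), (h2', h1')) (conj (esym kE4) (esym kE3)).
by case=> -> -> -> ->.
Qed.

Lemma zs_ex k : exists g h, k = val g * val h.
Proof. by have [[[g ?] [h ?]] [[<- _] _]] := zs k; exists g, h. Qed.

(** Uniqueness is stated for quadruples, so both factorizations are completed by the same [H]-[G]
    factorization. *)
Lemma zs_inj {g g' h h'} :
  val g * val h = val g' * val h' -> g = g' /\ h = h'.
Proof.
move=> eqgh; have [[[g1 g2] [h1 h2]] [[kE1 kE2] uniq]] := zs (val g * val h).
have [<- <-] := uniq ((g, g2), (h, h2)) (conj erefl kE2).
by have [<- <-] := uniq ((g', g2), (h', h2)) (conj (esym eqgh) kE2).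
Qed.

Lemma zs_val_eq {g h} : val g = val h -> g = 1 /\ h = 1.
Proof.
move=> gh; have := @zs_inj g 1 1 h; rewrite !gmulf1 mulg1 mul1g.
by move=> /(_ gh)[-> <-].
Qed.

(** Factoring the cofactor as [a * b] exhibits [g' * a] as the [G]-part. For [h = 1] this shows that
    prefixes computed in [K] between elements of [G] are prefixes in [G]. *)
Lemma prefix_zs {g g' h} :
  prefix_of (val g') (val g * val h) -> prefix_of g' g.
Proof.
move=> [u]; have [a [b ->]] := zs_ex u.
by rewrite mulgA -gmulfM => /zs_inj[-> _]; exists a.
Qed.

Lemma suffix_zs {g h h'} :
  suffix_of (val h') (val g * val h) -> suffix_of h' h.
Proof.
move=> [u]; have [a [b ->]] := zs_ex u.
by rewrite -mulgA -gmulfM => /zs_inj[_ ->]; exists b.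
Qed.

Lemma prefix_val g g' : prefix_of g g' -> prefix_of (val g) (val g').
Proof. by move=> [u ->]; exists (val u); rewrite gmulfM. Qed.

(** Both elements are prefixes of the [G]-part [a] of the join [j = a * b]; minimality makes [j] a
    prefix of [a], so [b] is trivial. *)
Lemma join_val (dK : K) g g' j : garside_element dK ->
  is_join (@prefix_of _) (val g) (val g') j -> exists g'', j = val g''.
Proof.
move=> gK [gj g'j jmin]; have [a [b jE]] := zs_ex j; exists a.
rewrite jE in gj g'j; have [u aE] : prefix_of j (val a).
  by apply: jmin; apply/prefix_val/prefix_zs; [exact: gj|exact: g'j].
have : val a * 1 = val a * (val b * u) by rewrite mulg1 mulgA -jE.
by move=> /(mulMI gK)/esym/(mul_eq1 gK)[b1 _]; rewrite jE b1 mulg1.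
Qed.

End ZappaSzepProduct.

(** * Joins and commuting squares in a Zappa-Szép Garside structure *)

Section ZappaSzepGarside.
Local Set Implicit Arguments.
Local Unset Strict Implicit.
Local Open Scope group_scope.
Variables (K : monoidType) (PG PH : pred K).
Variables (G : subMonoidType PG) (H : subMonoidType PH).
Variables (dK : K) (dG : G) (dH : H).
Hypothesis zs : zappa_szep G H.
Hypothesis gK : garside_element dK.
Hypothesis gG : garside_element dG.
Hypothesis gH : garside_element dH.
Hypothesis dKE : dK = val dG * val dH.
Implicit Types (g : G) (h : H) (k : K).
Let zs' := zs_sym zs.

(** The join [j] lies between [g] and [g * h'], so its [G]-part is [g]; likewise its leading
    [H]-part is [h]. It remains to see that the cofactor [u] of [j] is trivial. *)
Lemma join_zs {g g' h h'} : val g * val h' = val h * val g' ->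
  is_join (@prefix_of _) (val g) (val h) (val g * val h').
Proof.
move=> kE; have [j jP] := ex_join gK (val g) (val h).
suff -> : val g * val h' = j by [].
have [gj hj jmin] := jP.
have [u uE] : prefix_of j (val g * val h').
  by apply: jmin; [exists (val h') | rewrite kE; exists (val g')].
have [a [b jE]] := zs_ex zs j; have [b' [a' jE']] := zs_ex zs' j.
have ga : g = a.
  apply: (prefix_anti gG); first by apply: (prefix_zs zs (h := b)); rewrite -jE.
  by apply: (prefix_zs zs (h := h')); rewrite uE jE; exists (val b * u);
    rewrite mulgA.
have hb : h = b'.
  apply: (prefix_anti gH).
    by apply: (prefix_zs zs' (h := a')); rewrite -jE'.
  by apply: (prefix_zs zs' (h := g')); rewrite -kE uE jE'; exists (val a' * u);
    rewrite mulgA.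
have h'E : val h' = val b * u.
  by apply: (mulMI gK (x := val g)); rewrite mulgA uE jE -ga.
have g'E : val g' = val a' * u.
  by apply: (mulMI gK (x := val h)); rewrite mulgA -kE uE jE' -hb.
(* As a suffix of [g'], [u] has trivial [H]-part and lies in [G]; as a suffix of [h'] it lies in
   [H]. These submonoids meet trivially. *)
have [x [y ux]] := zs_ex zs u; have [y' [x' uy]] := zs_ex zs' u.
have y1 : 1 = y.
  apply: (proj2 (zs_inj zs (g := g') (g' := a' * x) _)).
  by rewrite gmulf1 mulg1 gmulfM -mulgA -ux.
have x1 : 1 = x'.
  apply: (proj2 (zs_inj zs' (g := h') (g' := b * y') _)).
  by rewrite gmulf1 mulg1 gmulfM -mulgA -uy.
have [x10 _] : x = 1 /\ y' = 1.
  apply: (zs_val_eq zs).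
  by move: ux uy; rewrite -y1 -x1 !gmulf1 !mulg1 => <- <-.
by rewrite uE ux -y1 x10 !gmulf1 !mulg1.
Qed.

(** Let [a] and [b] be the joins of [g1, g2] and of [h1, h2]. Left multiplication preserves joins,
    so [h * a] and [g * b] are the same join; comparing each given square with this one yields
    [g1 = a = g2]. *)
Lemma swap_inj {g h g1 g2 h1 h2} :
  val h * val g1 = val g * val h1 -> val h * val g2 = val g * val h2 ->
  g1 = g2.
Proof.
move=> eq1 eq2.
have [j jP] := ex_join gK (val g1) (val g2).
have [i iP] := ex_join gK (val h1) (val h2).
have [a jE] := join_val zs gK jP; have [b iE] := join_val zs' gK iP.
have {jE iE} [[g1j g2j jmin] [h1i h2i imin]] :
  is_join (@prefix_of _) (val g1) (val g2) (val a) /\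
  is_join (@prefix_of _) (val h1) (val h2) (val b) by rewrite -jE -iE.
have mul2l (x y z : K) : prefix_of y z -> prefix_of (x * y) (x * z).
  by move=> [u ->]; exists u; rewrite mulgA.
have ha_gb : val h * val a = val g * val b.
  apply: (prefix_anti gK).
    have [t tE] : prefix_of (val h) (val g * val b).
      apply: (prefix_trans gK (y := val h * val g1)); first by exists (val g1).
      by rewrite eq1; apply: mul2l.
    by rewrite tE; apply/mul2l/jmin; apply: (prefix_mul2l gK (x := val h));
      rewrite -tE ?eq1 ?eq2; apply: mul2l.
  have [t tE] : prefix_of (val g) (val h * val a).
    apply: (prefix_trans gK (y := val g * val h1)); first by exists (val h1).
    by rewrite -eq1; apply: mul2l.
  by rewrite tE; apply/mul2l/imin; apply: (prefix_mul2l gK (x := val g));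
    rewrite -tE -?eq1 -?eq2; apply: mul2l.
(* Writing [a = g' * u] and cancelling [g] gives [h' * u = b] with [u] in [G], so uniqueness of the
   factorization of [b] forces [u = 1]. *)
have eq_join g' h' : val h * val g' = val g * val h' ->
    prefix_of (val g') (val a) -> g' = a.
  move=> eq' g'a.
  have [u aE] : prefix_of g' a.
    by apply: (prefix_zs zs (h := 1)); rewrite gmulf1 mulg1.
  have : val h' * val u = val b * val (1 : G).
    apply: (mulMI gK (x := val g)).
    by rewrite mulgA -eq' -mulgA -gmulfM -aE ha_gb gmulf1 mulg1.
  by move=> /(zs_inj zs')[_ u1]; rewrite aE u1 mulg1.
by rewrite (eq_join _ _ eq1 g1j) (eq_join _ _ eq2 g2j).
Qed.

(** Factor [dK] as [h * g]. Since [dK], [dG] and [dH] are balanced, prefixes and suffixes can be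
    traded, and [h] and [dH], like [g] and [dG], divide each other. *)
Lemma swap_garside : dK = val dH * val dG.
Proof.
have [h [g kE]] := zs_ex zs' dK.
have -> : dH = h.
  apply: (prefix_anti gH).
    apply: (prefix_zs zs' (h := g)); rewrite -kE.
    by apply/(DivP gK); exists (val dG).
  apply/(DivP gH)/(suffix_zs zs (g := dG)); rewrite -dKE.
  by apply/(DivP gK); exists (val g).
suff -> : dG = g by [].
apply: (suffix_anti gG).
  apply: (suffix_zs zs' (g := h)); rewrite -kE.
  by apply/(DivP gK); exists (val dH).
apply/(DivP gG)/(prefix_zs zs (h := dH)); rewrite -dKE.
by apply/(DivP gK); exists (val h).
Qed.

(** [h * g] is a prefix of [h * dG], itself a suffix of [dH * dG = dK]; hence [g'] and [h'] divide
    [dK = dG * dH]. *)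
Lemma swap_Div {g h g' h'} : val h * val g = val g' * val h' ->
  Div dH h -> Div dG g -> Div dG g' /\ Div dH h'.
Proof.
move=> kE /(DivP gH)[x dHE] [y dGE].
have kd : Div dK (val h * val g).
  apply: (@Div_prefix _ _ gK _ (val h * val dG)).
    by exists (val y); rewrite dGE gmulfM mulgA.
  apply/(DivP gK); exists (val x).
  by rewrite swap_garside dHE gmulfM mulgA.
split.
  apply: (prefix_zs zs (h := dH)); rewrite -dKE.
  by apply: (Div_prefix gK _ kd); rewrite kE; exists (val h').
apply/(DivP gH)/(suffix_zs zs (g := dG)); rewrite -dKE.
by apply/(DivP gK)/(Div_suffix gK _ kd); rewrite kE; exists (val g').
Qed.

(* For a fixed [h], sending [g] to the [G]-part of [h g] is an injection of
   the finite set [Div dG] into itself, hence a surjection. *)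
Lemma swap_Div_surj g h : Div dG g -> Div dH h ->
  exists g' h', val h * val g' = val g * val h' /\ Div dH h'.
Proof.
move=> dg dh; have fin : finite_set (Div dG) by case: gG.
pose f (x : G) :=
  xget 1 [set y : G | exists h' : H, val h * val x = val y * val h'].
have fP x : exists h', val h * val x = val (f x) * val h'.
  apply: (@xgetPex _ 1
    [set y : G | exists h' : H, val h * val x = val y * val h']).
  by have [a [b]] := zs_ex zs (val h * val x); exists a, b.
have fD : set_fun (Div dG) (Div dG) f.
  by move=> x dx; have [h' /swap_Div[]] := fP x.
have fI : set_inj (Div dG) f.
  move=> x y _ _ fxy; have [h1 e1] := fP x; have [h2 e2] := fP y.
  by rewrite -fxy in e2; exact: swap_inj e1 e2.
have [x dx xg] : [set f x | x in Div dG] g.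
  exact: (finite_set_inj_surj fin).
have [h' xE] := fP x; have [_ dh'] := swap_Div xE dh dx.
by exists x, h'; rewrite -xg.
Qed.

(** The outer induction is on a factorization of [h] into divisors of [dH], the inner one on a
    factorization of [g] into divisors of [dG]. *)
Lemma swap_surj g h : exists g' h', val g * val h' = val h * val g'.
Proof.
have [w wd ->] : exists2 w : seq H, (forall y, y \in w -> Div dH y) &
  h = \prod_(y <- w) y by have [_ _ _ gen _] := gH; exact: gen.
elim: w wd g {h} => [|h w IHw] wd g.
  by exists g, 1; rewrite big_nil gmulf1 mulg1 mul1g.
have [x [h1 xE]] : exists (x : G) (h1 : H), val g * val h1 = val h * val x.
  have dh : Div dH h by apply: wd; rewrite mem_head.
  have [v vd ->] : exists2 v : seq G, (forall y, y \in v -> Div dG y) &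
    g = \prod_(y <- v) y by have [_ _ _ gen _] := gG; exact: gen.
  (* The side [h] is generalized: crossing a letter of [g] replaces it by another divisor of
     [dH]. *)
  elim: v vd h dh {g IHw wd} => [|g v IHv] vd h dh.
    by exists 1, h; rewrite big_nil gmulf1 mulg1 mul1g.
  have dg : Div dG g by apply: vd; rewrite mem_head.
  have [g1 [h1 [e1 dh1]]] := swap_Div_surj dg dh.
  have [|g2 [h2 e2]] := IHv _ h1 dh1.
    by move=> y yv; apply: vd; rewrite inE yv orbT.
  exists (g1 * g2), h2.
  by rewrite big_cons !gmulfM -mulgA e2 !mulgA e1.
have [|g' [h' e']] := IHw _ x.
  by move=> y yw; apply: wd; rewrite inE yw orbT.
exists g', (h1 * h'); rewrite big_cons !gmulfM.
by rewrite mulgA xE -mulgA e' mulgA.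
Qed.

Lemma join_val_inj g g' h h' :
  join (val g) (val h) = join (val g') (val h') -> g = g' /\ h = h'.
Proof.
have [g1 [h1 e]] := swap_surj g h; have [g1' [h1' e']] := swap_surj g' h'.
rewrite (join_eq gK (join_zs e)) (join_eq gK (join_zs e')) => k.
split; first by have [] := zs_inj zs k.
by rewrite e e' in k; have [] := zs_inj zs' k.
Qed.

Lemma join_val_surj k : exists g h, join (val g) (val h) = k.
Proof.
have [g [h1 e]] := zs_ex zs k; have [h [g1 e']] := zs_ex zs' k.
by exists g, h; rewrite e; apply/(join_eq gK)/(@join_zs _ g1); rewrite -e.
Qed.

End ZappaSzepGarside.

Theorem corollary55 (K : monoidType) (PG PH : pred K)
    (G : subMonoidType PG) (H : subMonoidType PH)
    (dK : K) (dG : G) (dH : H) :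
  zappa_szep G H ->
  zappa_szep_garside dK dG dH ->
  set_bij (left_normal dG `*` left_normal dH) (left_normal dK)
          (psi (G := G) (H := H) dK).
Proof.
move=> zs [_ gK gG gH dKE]; split.
- by move=> w _; have [] := NFP gK (join (val (\prod_(g <- w.1) g)%g)
    (val (\prod_(h <- w.2) h)%g)).
- move=> [u v] [u' v'] /set_mem[/= nu nv] /set_mem[/= nu' nv'] eq_psi.
  have [eu ev] := join_val_inj zs gK gG gH dKE (NF_inj gK eq_psi).
  by rewrite (left_normal_inj gG nu nu' eu) (left_normal_inj gH nv nv' ev).
move=> w nw.
have [g [h gh]] := join_val_surj zs gK gG gH (\prod_(x <- w) x)%g.
exists (NF dG g, NF dH h).
  by split; [case: (NFP gG g) | case: (NFP gH h)].
rewrite /psi /=; have [_ <-] := NFP gG g; have [_ <-] := NFP gH h.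
by rewrite gh NF_prod.
Qed.
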